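(* Let $X$ be a Hausdorff topological space whose topology is given by a countable family $\mathcal G$ of real-valued functions on $X$, i.e. it is the weakest topology on $X$ with respect to which all elements of $\mathcal G$ are continuous. Then there exists a uniform structure $\mathcal U$ on $X$ such that the uniform space $(X,\mathcal U)$ is complete and the topology $\tau_{\mathcal U}$ induced by $\mathcal U$ coincides with the given topology on $X$.
   Context: A uniform space $(X,\mathcal U)$ is complete if each Cauchy filter on $X$ converges in the topology $\tau_{\mathcal U}$ induced by $\mathcal U$. *)

(* Defs.v *)
From mathcomp Require Import all_boot all_order all_algebra.
From mathcomp Require Import all_classical all_reals all_analysis.
Import numFieldNormedType.Exports.

Set Implicit Arguments.
Unset Strict Implicit.
Unset Printing Implicit Defensive.

Local Open Scope classical_set_scope.

(* [Topological X] is the type of topological structures on the carrier of X,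
   compared with the given one by inclusion of their open sets. *)
Definition weakest_topology (R : realType) (X : topologicalType)
    (G : set (X -> R)) : Prop :=
  (forall g, G g -> continuous g) /\
  (forall tau : Topological X,
     (forall g, G g -> continuous (g : Topological.Pack tau -> R)) ->
     @open X `<=` @open (Topological.Pack tau)).

(* The library's [completeType] demands a point; this version also covers the
   empty space. *)
Definition complete_uniform (T : uniformType) : Prop :=
  forall F : set_system T,
    ProperFilter F -> cauchy F -> exists x : T, F --> x.

(* Main.v *)
(** Take the coarsest uniformity making every continuous function [X -> R]
uniformly continuous.  Let [F] be a Cauchy filter and enumerate the family as
[g_n]; then [g_n] converges along [F] to some real [l_n].  If some [x] satisfies
[g_n x = l_n] for all [n], then [F] converges to [x].  Otherwise
[h x = sup_n min (1/(n+1)) |g_n x - l_n|] is continuous and positive on [X], and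
it tends to [0] along [F]; but [1/h] is continuous too, so it converges along
[F], which is absurd since [h * (1/h) = 1]. *)

Require Import Defs.
From HB Require Import structures.
From mathcomp Require Import all_boot all_order all_algebra.
From mathcomp Require Import finmap lra.
From mathcomp Require Import all_classical all_reals all_analysis.
Import numFieldNormedType.Exports.
Import Order.TTheory GRing.Theory Num.Theory.

Local Open Scope classical_set_scope.
Local Open Scope ring_scope.

(** The default [t0] serves as a constant sequence when [D] is empty; otherwise the sequence is a
    surjection of [nat] onto [D]. *)
Lemma countable_sub_range (T : Type) (D P : set T) (t0 : T) :
  P t0 -> D `<=` P -> countable D ->
  exists t : nat -> T, D `<=` range t /\ forall n, P (t n).
Proof.
move=> Pt0 DP /pfcard_geP[->|/surjfunPex[t Dt]]; first by exists (fun=> t0); split=> //; exact: sub0set.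
exists t; rewrite -Dt; split=> // n; apply: DP.
by rewrite Dt; exists n.
Qed.

Lemma cvg_initial_topology (S : choiceType) (T : topologicalType) (f : S -> T)
    (F : set_system S) (x : S) :
  Filter F -> f @ F --> f x -> F --> (x : initial_topology f).
Proof.
move=> FF Ffx A [_ [[B oB <-] Bfx]] /filterS; apply.
by apply: Ffx; exact: open_nbhs_nbhs.
Qed.

(** Finite intersections of entourages of the [Tc i] form a base of the supremum uniformity, and [E]
    is the intersection of the one-element family [p]. *)
Lemma entourage_sup_topology (T : choiceType) (I : Type) (Tc : I -> Uniform T)
    (i : I) (E : set (T * T)) :
  @entourage (Uniform.Pack (Tc i)) E -> @entourage (sup_topology Tc) E.
Proof.
move=> entE.
have Ei : `[< @entourage (Uniform.Pack (Tc i)) E >] by exact/asboolP.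
exists E => //.
pose p := exist (fun p : {classic I} * set (T * T) =>
  `[< @entourage (Uniform.Pack (Tc p.1)) p.2 >]) (i, E) Ei.
exists [fset p]%fset; first by move=> ? _; exact: in_setT.
rewrite eqEsubset; split=> z; first by move=> /(_ p); apply; rewrite /= inE.
by move=> Ez q /=; rewrite inE => /eqP ->.
Qed.

Section initial_family.
Context {R : realType} {X : choiceType}.
Implicit Type P : set (X -> R).

(** An alias of [X] carrying the coarsest uniformity that makes every member of [P] uniformly
    continuous, so that it can coexist with a topology already on [X]. *)
Definition initial_family P : Type :=
  sup_topology (fun f : {f | P f} =>
    Uniform.class (initial_topology (projT1 f))).

HB.instance Definition _ P := Uniform.on (initial_family P).

Lemma cvg_initial_family P (F : set_system X) (x : X) : Filter F ->
  (forall f, P f -> f @ F --> f x) -> F --> (x : initial_family P).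
Proof.
move=> FF cvF; apply/cvg_sup => -[f Pf].
by apply: cvg_initial_topology; exact: cvF.
Qed.

Lemma initial_family_continuous P (f : X -> R) :
  P f -> continuous (f : initial_family P -> R).
Proof.
move=> Pf x.
have /cvg_sup/(_ (exist _ f Pf)) idx : nbhs (x : initial_family P) --> x by [].
exact: cvg_trans (cvg_app f idx) (@initial_continuous _ _ f x).
Qed.

Lemma cauchy_initial_family P (f : X -> R) (F : set_system (initial_family P)) :
  Filter F -> P f -> cauchy F -> cauchy (f @ F).
Proof.
move=> FF Pf cF E entE.
have /cF : entourage ((fun xy => (f xy.1, f xy.2)) @^-1` E
    : set (initial_family P * initial_family P)).
  apply: (@entourage_sup_topology _ _ _ (exist _ f Pf)).
  by exists E.
move=> [[A B] [/= FA FB] AB].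
exists (f @` A, f @` B); first by split; [apply: filterS FA|apply: filterS FB] => y; exists y.
by move=> [_ _] [/= [a Aa <-] [b Bb <-]]; exact: (AB (a, b)).
Qed.

End initial_family.

(** The topology of [initial_family G] makes all of [G] continuous, so by minimality it contains
    every open set of [X]; convergence in it is tested on [G] alone. *)
Lemma weakest_topology_cvg (R : realType) (X : topologicalType)
    (G : set (X -> R)) (F : set_system X) (x : X) :
  weakest_topology G -> Filter F ->
  (forall g, G g -> g @ F --> g x) -> F --> x.
Proof.
move=> [_ weakG] FF cvF A; rewrite nbhsE => -[B [oB Bx] /filterS]; apply.
have oB' : open (B : set (initial_family G)).
  apply: (weakG (Topological.class (initial_family G))) oB.
  exact: initial_family_continuous.
by apply: (cvg_initial_family G F x) => //; exact: open_nbhs_nbhs.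
Qed.

(** The bounds [1/(n+1)] make all but finitely many terms close to their limits at every point, so
    convergence is uniform in [n], and a supremum moves by at most [e] when each term does. *)
Lemma cvg_sup_range (R : realType) (T : Type) (F : set_system T)
    (u : nat -> T -> R) (l : nat -> R) : Filter F ->
  (forall n x, 0 <= u n x <= n.+1%:R^-1) ->
  (forall n, 0 <= l n <= n.+1%:R^-1) ->
  (forall n, u n @ F --> l n) ->
  (fun x => sup (range (u ^~ x))) @ F --> sup (range l).
Proof.
move=> FF ub lb ul; apply/cvgrPdist_le => e e0.
have near_init N : \forall x \near F, forall n, (n < N)%N -> `|l n - u n x| <= e.
  elim: N => [|N IHN]; first exact: nearW.
  have uN := (cvgrPdist_le _ _).1 (ul N) e e0.
  near=> x => n; rewrite ltnS leq_eqVlt => /predU1P[->|]; first by near: x; exact: uN.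
  by move: n; near: x; exact: IHN.
have has_sup_unit (v : nat -> R) :
    (forall n, 0 <= v n <= n.+1%:R^-1) -> has_sup (range v).
  move=> vb; split; first by exists (v 0%N), 0%N.
  exists 1 => _ [n _ <-]; have /andP[_ /le_trans] := vb n; apply.
  by rewrite invf_le1 ?ltr0n// ler1n.
have sup_close (v w : nat -> R) : (forall n, 0 <= w n <= n.+1%:R^-1) ->
    (forall n, `|v n - w n| <= e) -> sup (range v) <= sup (range w) + e.
  move=> wb vw; apply: ge_sup; first by exists (v 0%N), 0%N.
  move=> _ [n _ <-]; have := vw n; rewrite ler_distl => /andP[_ /le_trans]; apply.
  rewrite lerD2r; apply: ub_le_sup; last by exists n.
  by have [] := has_sup_unit _ wb.
(* For [n >= N] one has [n + 1 > 1/e], so [u n x] and [l n] both lie in [[0, e]]. *)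
pose N := Num.truncn e^-1.
near=> x.
have close n : `|l n - u n x| <= e.
  have [nN|Nn] := ltnP n N; first by move: n nN; near: x; exact: near_init.
  have /andP[l0 l1] := lb n; have /andP[u0 u1] := ub n x.
  have ne : n.+1%:R^-1 <= e.
    rewrite -[leRHS]invrK lef_pV2 ?posrE ?invr_gt0 ?ltr0n//.
    apply/ltW; apply: lt_le_trans (truncnS_gt _) _.
    by rewrite ler_nat.
  move: l0 l1 u0 u1 ne; move: (l n) (u n x) (_^-1) => a b c *.
  by rewrite ler_distl; apply/andP; split; lra.
rewrite ler_distl lerBlDr !sup_close// => n; by rewrite distrC.
Unshelve. all: by end_near. Qed.

Lemma continuous_uniformity_complete (R : realType) (X : topologicalType)
    (G : set (X -> R)) :
  countable G -> weakest_topology G ->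
  complete_uniform (initial_family [set f : X -> R | continuous f]).
Proof.
set P := [set f : X -> R | continuous f] => cG weakG F PF cF.
have [|f [Gf fc]] := countable_sub_range _ G P (fun=> 0) _ weakG.1 cG.
  exact: cst_continuous.
have F_cvg h : P h -> cvg (h @ F).
  by move=> Ph; apply: cauchy_cvg; apply: (cauchy_initial_family P).
pose l n := lim (f n @ F).
have fl n : f n @ F --> l n by apply: F_cvg; exact: fc.
have [[x xl]|no_lim] := pselect (exists x, forall n, f n x = l n).
  exists x; apply: cvg_initial_family => h Ph.
  have Fx : F --> (x : X).
    apply: (weakest_topology_cvg R X G) => // g /Gf[n _ <-].
    by rewrite xl; exact: fl.
  exact: cvg_trans (cvg_app h Fx) (Ph x).
exfalso.
(* Truncating the distance to [l n] at [1/(n+1)] gives the bounds required by [cvg_sup_range], which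
   is used twice: along [nbhs x] for the continuity of [h], and along [F] for its limit. *)
pose dist n (a : R) := Num.min n.+1%:R^-1 `|a - l n|.
have dist_cont n : continuous (dist n).
  move=> a; apply: (@continuous_min _ _ (cst n.+1%:R^-1) (fun a => `|a - l n|)).
    exact: cst_continuous.
  apply: continuous_comp; last exact: norm_continuous.
  by apply: cvgB => //; exact: cvg_cst.
have dist_bound n a : 0 <= dist n a <= n.+1%:R^-1.
  by rewrite le_min invr_ge0 ler0n normr_ge0 ge_min lexx.
pose h x := sup (range (fun n => dist n (f n x))).
have h_gt0 x : 0 < h x.
  have [n fn] : exists n, f n x != l n.
    apply: contrapT => /forallNP nfl; apply: no_lim; exists x => n.
    by apply/eqP/negPn/negP; exact: nfl.
  apply: (@lt_le_trans _ _ (dist n (f n x))).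
    by rewrite lt_min invr_gt0 ltr0n normr_gt0 subr_eq0.
  apply: ub_le_sup; last by exists n.
  exists 1 => _ [m _ <-]; have /andP[_ /le_trans] := dist_bound m (f m x).
  by apply; rewrite invf_le1 ?ltr0n// ler1n.
have h_cont : continuous h.
  move=> x; apply: (@cvg_sup_range R X (nbhs x) (fun n => dist n \o f n)) => n.
  - by move=> ?; exact: dist_bound.
  - exact: dist_bound.
  by apply: continuous_comp; [exact: fc|exact: dist_cont].
have hF : h @ F --> sup (range (fun n => dist n (l n))).
  apply: (@cvg_sup_range R X F (fun n => dist n \o f n)) => n.
  - by move=> ?; exact: dist_bound.
  - exact: dist_bound.
  by apply: continuous_cvg; [exact: dist_cont|exact: fl].
have supl : sup (range (fun n => dist n (l n))) = 0.
  rewrite [X in sup X](_ : _ = [set 0]) ?sup1//.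
  have d0 n : dist n (l n) = 0.
    by rewrite /dist subrr normr0 min_r// invr_ge0.
  by apply/seteqP; split=> [_ [n _ <-]|_ ->]; [rewrite d0|exists 0%N].
rewrite supl in hF.
(* Here it matters that the uniformity comes from all continuous functions and not only from [G]: it
   forces [1/h] to converge along [F]. *)
have hV : P (fun x => (h x)^-1).
  by move=> x; apply: cvgV; [rewrite gt_eqF|exact: h_cont].
have := cvgM hF (F_cvg _ hV); rewrite mul0r.
have -> : (h \* (fun x => (h x)^-1)) = cst 1.
  by apply/funext => x /=; rewrite divff// gt_eqF.
move=> F0; have /eqP : 1 = 0 :> R.
  exact: (cvg_unique (@norm_hausdorff _ _) (cvg_cst (1 : R)) (F0 _)).
by rewrite oner_eq0.
Qed.

(** Each neighbourhood filter converges to its point in the other topology: members of [P] are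
    continuous on [X], and [G] is contained in [P]. *)
Lemma open_continuous_uniformity (R : realType) (X : topologicalType)
    (G : set (X -> R)) :
  weakest_topology G ->
  @open (initial_family [set f : X -> R | continuous f]) = @open X.
Proof.
set P := [set f : X -> R | continuous f] => weakG.
apply/seteqP; split=> A; rewrite !openE => oA x Ax.
- by apply: (@cvg_initial_family R X P (nbhs x) x (nbhs_filter x) _ A (oA x Ax)) => f; exact.
- apply: (@weakest_topology_cvg R X G (nbhs (x : initial_family P)) x weakG
    (nbhs_filter (x : initial_family P)) _ A (oA x Ax)) => g /weakG.1 gc.
  exact: (@initial_family_continuous _ _ P).
Qed.

Theorem corollary4p1 (R : realType) (X : topologicalType) (G : set (X -> R)) :
  hausdorff_space X ->
  countable G ->
  weakest_topology G ->
  exists U : Uniform X,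
    complete_uniform (Uniform.Pack U) /\ @open (Uniform.Pack U) = @open X.
Proof.
move=> _ cG weakG.
exists (Uniform.class (initial_family [set f : X -> R | continuous f])); split.
- exact: continuous_uniformity_complete cG weakG.
- exact: open_continuous_uniformity weakG.
Qed.
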